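(* Let $\Lambda$ be a lattice in $\mathbb{C}^2$, let $d\in\mathbb{Z}\setminus\{n^2:n\in\mathbb{Z}\}$, and let $D\in \mathrm{M}_2(\mathbb{C})$ be a nonscalar matrix with $D\Lambda\subseteq\Lambda$ and $D^2=d$ (i.e. $D^2$ is $d$ times the identity matrix). Define $$N_D=\{H(x,y)\in \mathrm{NS}(\mathbb{C}^2/\Lambda)\ \text{ such that }\ H(x,Dy)\in \mathrm{NS}(\mathbb{C}^2/\Lambda)\}\subseteq \mathrm{NS}(\mathbb{C}^2/\Lambda).$$ Then $N_D\simeq\mathbb{Z}^2$ (as an abelian group), and: (1) if $d>0$, then $N_D$ contains positive definite hermitian forms; (2) if $d<0$, then $N_D$ contains no positive definite hermitian form.
   Context: A lattice in $\mathbb{C}^2$ is a discrete subgroup of rank $4$ (so it spans $\mathbb{C}^2$ over $\mathbb{R}$), and $\mathbb{C}^2/\Lambda$ is the corresponding complex torus. A hermitian form $H$ on $\mathbb{C}^2$ is a form $H(x,y)=x^tM\overline{y}$ with $M\in \mathrm{M}_2(\mathbb{C})$ satisfying $\overline{M}^t=M$ (linear in the first argument, conjugate-linear in the second); it is not assumed to be definite or nondegenerate. The Néron-Severi group $\mathrm{NS}(\mathbb{C}^2/\Lambda)$ is the additive group of hermitian forms $H$ on $\mathbb{C}^2$ such that $\mathrm{Im}\,H(\Lambda,\Lambda)\subseteq\mathbb{Z}$. The condition $H(x,Dy)\in\mathrm{NS}(\mathbb{C}^2/\Lambda)$ means that the form $(x,y)\mapsto H(x,Dy)$ is itself a hermitian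 form on $\mathbb{C}^2$ and belongs to $\mathrm{NS}(\mathbb{C}^2/\Lambda)$. *)

(* Defs.v *)
From mathcomp Require Import all_boot all_order all_algebra.
From mathcomp Require Export complex.
From mathcomp Require Import all_classical all_reals topology normedtype.

Set Implicit Arguments.
Unset Strict Implicit.
Unset Printing Implicit Defensive.

Import Order.TTheory GRing.Theory Num.Theory Num.Def.
Import numFieldNormedType.Exports.
Local Open Scope classical_set_scope.
Local Open Scope ring_scope.

(* [A] is a subgroup of [V] isomorphic to Z^n: an injective additive map
   Z^n -> V has image exactly [A] (in particular [A] is a subgroup). *)
Definition iso_Zn (V : zmodType) (n : nat) (A : set V) : Prop :=
  exists f : {additive 'rV[int]_n -> V}, injective f /\ range f = A.

Section HermitianForms.
(* Instantiated with R[i], R : realType. Stating the definitions over an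
   abstract numClosedFieldType gives access to the topology that the library
   derives from the norm, which is not declared on R[i] itself. *)
Variable C : numClosedFieldType.

Definition is_lattice (L : set 'cV[C]_2) : Prop :=
  isolated L = L /\ iso_Zn 4 L.

Definition hermitian_form (H : 'cV[C]_2 -> 'cV[C]_2 -> C) : Prop :=
  exists2 M : 'M[C]_2, M \is hermsymmx &
    forall x y, H x y = (x^T *m M *m map_mx conjC y) 0 0.

Definition NS (L : set 'cV[C]_2) : set ('cV[C]_2 -> 'cV[C]_2 -> C) :=
  [set H | hermitian_form H /\
    forall x y, L x -> L y -> exists k : int, 'Im (H x y) = k%:~R].

Definition N_D (L : set 'cV[C]_2) (D : 'M[C]_2) :
    set ('cV[C]_2 -> 'cV[C]_2 -> C) :=
  [set H | NS L H /\ NS L (fun x y => H x (D *m y))].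

(* In the order of C, [0 < z] means that z is real and positive. *)
Definition positive_definite (H : 'cV[C]_2 -> 'cV[C]_2 -> C) : Prop :=
  forall x, x != 0 -> 0 < H x x.

End HermitianForms.

(* Main.v *)
From HB Require Import structures.
Require Import Defs.
From mathcomp Require Import all_boot all_order all_algebra.
From mathcomp Require Import all_classical all_reals topology normedtype.
From mathcomp Require Import ring lra.
Set Implicit Arguments.
Unset Strict Implicit.
Unset Printing Implicit Defensive.
Import Order.TTheory GRing.Theory Num.Theory.
Import numFieldNormedType.Exports.
Local Open Scope classical_set_scope.
Local Open Scope ring_scope.

(** Let E = Im H. If H lies in N_D, then D is self-adjoint for H, that is
H(Dx, y) = H(x, Dy), and conversely a hermitian form with this property and
with E integral on the lattice lies in N_D. Since d is not a square, Q(sqrt d)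
is a field, acting on the rational span of the lattice through D, which is
therefore a plane over this field: there are lattice vectors l1, l2 such that
l1, D l1, l2, D l2 are linearly independent, and N times the lattice lies in
their integral span for some N > 0 ([lattice_frame]). The form E is alternating
and D is self-adjoint for it, so E is determined by the two numbers E(l1, l2)
and E(l1, D l2) ([selfadjoint_Im_frame]), and H by E. Hence N_D embeds in Z^2,
and it is isomorphic to Z^2 as soon as it contains a form K with E(l1, l2) != 0
and E(l1, D l2) = 0, because K(x, Dy) then has the values 0 and d E(l1, l2)
([rank_two_subgroup], [N_D_iso_Z2]).

To find K, average a hermitian form G into H(x, y) = G(Dx, Dy) + d G(x, y),
for which D is self-adjoint because D^2 = d. If d > 0, then G can be taken
positive definite, and H is positive definite; in any case some G gives a
nonzero H, because D is not scalar ([exists_selfadjoint_form]). Let p and q be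
the values of Im H at (l1, l2) and (l1, D l2). The form H(x, Dy) has the values
q and d p, so a real combination K = u H(x, y) + v H(x, Dy) has prescribed
values as soon as d p^2 - q^2 != 0. If this failed, H(x, Dy) would be r H(x, y)
for a real r with r^2 = d; then d > 0, so H is definite and D = r would be
scalar ([twist_norm_neq0]). Prescribing the values N^2 and 0 makes K integral
on the lattice ([exists_N_D]).

If d > 0 and H is positive definite, the form u H(x, y) + v H(x, Dy) is
positive definite when u > 0 and u^2 > d v^2, by completing the square. Passing
from K(x, y) to K(x, Dy) multiplies u^2 - d v^2 by - d, so one of K, - K,
K(x, Dy), - K(x, Dy) is positive definite. If d < 0, then
H(Dx, Dx) = d H(x, x) excludes positive definite forms.

The existence of the frame rests on one consequence of discreteness, proved by
simultaneous approximation: a lattice vector that is a real combination of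
lattice vectors has a positive multiple that is an integral combination of them
([discrete_real_combination]). *)

(** * Subgroups of rank two *)

Lemma subgroup_mulrz (V : zmodType) (A : set V) (u : V) (k : int) :
  A 0 -> (forall x y, A x -> A y -> A (x - y)) -> A u -> A (u *~ k).
Proof.
move=> A0 AB Au.
have AN x : A x -> A (- x) by move=> Ax; rewrite -sub0r; exact: (AB).
have An n : A (u *+ n).
  elim: n => [|n IHn]; first by rewrite mulr0n.
  by rewrite mulrSr -[u in _ + u]opprK; apply: (AB) => //; exact: AN.
by case: k => n; rewrite ?NegzE ?mulrNz -pmulrn; [|apply: AN].
Qed.

(** The integers phi takes on A form a subgroup of Z, generated by its least
positive element. *)
Lemma subgroup_functional_generator (V : zmodType) (F : numDomainType)
    (A : set V) (phi : {additive V -> F}) :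
  A 0 -> (forall x y, A x -> A y -> A (x - y)) ->
  (forall x, A x -> exists k : int, phi x = k%:~R) ->
  (exists2 x, A x & phi x != 0) ->
  exists u, [/\ A u, phi u != 0 &
    forall x, A x -> exists k : int, phi (x - u *~ k) = 0].
Proof.
move=> A0 AB Aint [x0 Ax0 x0n].
pose P n := `[< exists2 u, A u & phi u = n.+1%:R >].
have exP : exists n, P n.
  have [k phik] := Aint _ Ax0.
  have: (k != 0) by apply: contra x0n => /eqP k0; rewrite phik k0 mulr0z.
  case: k phik => [[//|n]|n] phik _; exists n; apply/asboolP.
    by exists x0.
  exists (- x0); first by rewrite -sub0r; exact: (AB).
  by rewrite raddfN /= phik NegzE mulrNz opprK -pmulrn.
case: (ex_minnP exP) => n /asboolP[u Au phiu] minn.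
exists u; split => //; first by rewrite phiu pnatr_eq0.
move=> x Ax; have [k phik] := Aint _ Ax.
exists (k %/ n.+1%:Z)%Z.
have Ay : A (x - u *~ (k %/ n.+1%:Z)%Z) by apply: (AB) => //; exact: subgroup_mulrz.
have phiy : phi (x - u *~ (k %/ n.+1%:Z)%Z) = (k %% n.+1%:Z)%Z%:~R.
  rewrite raddfB /= raddfMz /= phik phiu {1}(divz_eq k n.+1) intrD intrM.
  by rewrite pmulrn -mulrzl -pmulrn; ring.
have := modz_ge0 k (isT : n.+1%:Z != 0).
have := ltz_pmod k (isT : 0 < n.+1%:Z).
case: (k %% _)%Z phiy => [[|r]|//] phiy; first by rewrite phiy mulr0z.
rewrite ltz_nat ltnS => ltrn _.
have /minn : P r by apply/asboolP; exists (x - u *~ (k %/ n.+1%:Z)%Z).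
by rewrite leqNgt ltrn.
Qed.

(** The basis is triangular: u generates A modulo the kernel of phi, and v
generates that kernel, where psi is injective. The determinant condition
makes phi nonzero on A and psi nonzero on the kernel of phi. *)
Lemma rank_two_subgroup (V : zmodType) (F : numDomainType)
    (A : set V) (phi psi : {additive V -> F}) (g h : V) :
  A 0 -> (forall x y, A x -> A y -> A (x - y)) ->
  (forall x, A x -> exists k : int, phi x = k%:~R) ->
  (forall x, A x -> exists k : int, psi x = k%:~R) ->
  (forall x, A x -> phi x = 0 -> psi x = 0 -> x = 0) ->
  A g -> A h -> phi g * psi h - phi h * psi g != 0 ->
  iso_Zn 2 A.
Proof.
move=> A0 AB phiZ psiZ inj Ag Ah det.
have AN x : A x -> A (- x) by move=> Ax; rewrite -sub0r; exact: (AB).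
have AD x y : A x -> A y -> A (x + y).
  by move=> Ax Ay; rewrite -[y]opprK; apply: (AB) => //; exact: AN.
have AM x k : A x -> A (x *~ k) by exact: subgroup_mulrz.
have [u [Au phiu u_gen]] : exists u, [/\ A u, phi u != 0 &
    forall x, A x -> exists k : int, phi (x - u *~ k) = 0].
  apply: subgroup_functional_generator => //.
  have [g0|gn] := eqVneq (phi g) 0; last by exists g.
  exists h => //; apply: contra det => /eqP h0.
  by rewrite g0 h0 !mul0r subrr.
pose B := [set x | A x /\ phi x = 0].
have [v [[Av phiv] psiv v_gen]] : exists v, [/\ B v, psi v != 0 &
    forall x, B x -> exists k : int, psi (x - v *~ k) = 0].
  apply: subgroup_functional_generator.
  - by split; rewrite ?raddf0.
  - move=> x y [Ax x0] [Ay y0]; split; first exact: (AB).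
    by rewrite raddfB /= x0 y0 subrr.
  - by move=> x [/psiZ].
  have [a phig] := phiZ _ Ag; have [b phih] := phiZ _ Ah.
  (* this integral combination of g and h lies in the kernel of phi, and psi
     maps it to the determinant *)
  exists (h *~ a - g *~ b).
    split; first by apply: (AB); exact: AM.
    by rewrite raddfB /= !raddfMz /= phig phih mulNrz -!mulrzA mulrC subrr.
  by move: det; rewrite raddfB /= !raddfMz /= phig phih mulNrz !mulrzl.
pose f (w : 'rV[int]_2) := u *~ w 0 0 + v *~ w 0 1.
have f_add : zmod_morphism f.
  by move=> x y; rewrite /f !mxE !mulrzBr opprD !addrA; congr (_ + _); rewrite addrAC.
pose fM := GRing.isZmodMorphism.Build _ _ f f_add.
pose fA : {additive 'rV[int]_2 -> V} := HB.pack f fM.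
exists fA; split.
  apply: raddf_inj => w; rewrite /= /f => fw0.
  have w0 : w 0 0 = 0.
    have := congr1 phi fw0; rewrite raddfD /= !raddfMz /= phiv mul0rz addr0 raddf0.
    by move=> /eqP; rewrite mulrz_eq0 (negPf phiu) orbF => /eqP.
  have w1 : w 0 1 = 0.
    have := congr1 psi fw0; rewrite w0 mulr0z add0r raddfMz /= raddf0.
    by move=> /eqP; rewrite mulrz_eq0 (negPf psiv) orbF => /eqP.
  apply/rowP => j; rewrite mxE.
  by case: j => [[|[|//]]] lt_j; [rewrite -w0|rewrite -w1]; congr (w _ _); exact: val_inj.
apply/seteqP; split => [_ [w _ <-]|x Ax] /=.
  by rewrite /f; apply: AD; exact: AM.
have [k phi0] := u_gen _ Ax.
have Bx : B (x - u *~ k) by split => //; apply: (AB) => //; exact: AM.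
have [l psi0] := v_gen _ Bx.
exists (\row_j if j == 0 then k else l) => //=.
rewrite /f !mxE /=; apply/esym/subr0_eq; rewrite opprD addrA.
apply: inj => //; first by apply: (AB); [case: Bx|exact: AM].
by rewrite raddfB /= phi0 raddfMz /= phiv mul0rz subrr.
Qed.

(** * Hermitian forms and self-adjoint endomorphisms *)

Section HermitianAlgebra.
Variable C : numClosedFieldType.
Implicit Types (H G : 'cV[C]_2 -> 'cV[C]_2 -> C) (x y z : 'cV[C]_2).

(** The axiomatic description makes closure properties immediate; the matrix is
recovered from the values on the standard basis. *)
Lemma hermitian_formP H :
  hermitian_form H <->
  (forall a x z y, H (a *: x + z) y = a * H x y + H z y) /\
  (forall x y, H y x = (H x y)^*).
Proof.
split=> [[M /is_hermitianmxP Mh HE]|[linH conjH]].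
  rewrite expr0 scale1r in Mh.
  split=> [a x z y|x y]; rewrite !HE.
    by rewrite linearP /= !mulmxDl -!scalemxAl !mxE.
  have tr (A : 'M[C]_1) : (A 0 0)^* = (map_mx Num.conj A^T) 0 0 by rewrite !mxE.
  rewrite tr !trmx_mul !map_mxM mulmxA {1}Mh /=.
  congr ((_ *m _ *m _) 0 0); apply/matrixP => i j; rewrite !mxE ?conjCK //.
have H0 y : H 0 y = 0.
  have := linH 1 0 0 y; rewrite scaler0 addr0 mul1r => /eqP.
  by rewrite -subr_eq0 opprD addNKr oppr_eq0 => /eqP.
have lin_sum (c : 'I_2 -> C) (f : 'I_2 -> 'cV[C]_2) y :
    H (\sum_i c i *: f i) y = \sum_i c i * H (f i) y.
  by rewrite !big_ord_recl !big_ord0 !linH H0.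
pose e (i : 'I_2) : 'cV[C]_2 := delta_mx i 0.
have decomp x : x = \sum_i x i 0 *: e i.
  by rewrite {1}(matrix_sum_delta x); apply: eq_bigr => i _; rewrite big_ord1.
exists (\matrix_(i, j) H (e i) (e j)).
  apply/is_hermitianmxP; rewrite expr0 scale1r; apply/matrixP => i j.
  by rewrite !mxE conjH.
move=> x y; rewrite {1}(decomp x) lin_sum -mulmxA !mxE; apply: eq_bigr => i _.
rewrite !mxE; congr (_ * _); rewrite conjH {1}(decomp y) lin_sum rmorph_sum.
by apply: eq_bigr => j _; rewrite !mxE rmorphM /= -conjH mulrC.
Qed.

Lemma hermitian_formC H x y : hermitian_form H -> H y x = (H x y)^*.
Proof. by case/hermitian_formP. Qed.

Lemma hermitian_form_linearl H a x z y :
  hermitian_form H -> H (a *: x + z) y = a * H x y + H z y.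
Proof. by case/hermitian_formP. Qed.

Lemma hermitian_form0l H y : hermitian_form H -> H 0 y = 0.
Proof.
move=> hH; have := hermitian_form_linearl 1 0 0 y hH.
rewrite scaler0 addr0 mul1r => /eqP.
by rewrite -subr_eq0 opprD addNKr oppr_eq0 => /eqP.
Qed.

Lemma hermitian_formDl H x z y : hermitian_form H -> H (x + z) y = H x y + H z y.
Proof. by move=> hH; rewrite -[x]scale1r hermitian_form_linearl ?mul1r ?scale1r. Qed.

Lemma hermitian_formZl H a x y : hermitian_form H -> H (a *: x) y = a * H x y.
Proof.
by move=> hH; rewrite -[_ *: _]addr0 hermitian_form_linearl ?hermitian_form0l ?addr0.
Qed.

Lemma hermitian_formDr H x y z : hermitian_form H -> H x (y + z) = H x y + H x z.
Proof.
move=> hH; rewrite (hermitian_formC (y + z)) // hermitian_formDl // rmorphD /=.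
by rewrite -!hermitian_formC.
Qed.

Lemma hermitian_formZr H a x y : hermitian_form H -> H x (a *: y) = a^* * H x y.
Proof.
move=> hH; rewrite (hermitian_formC (a *: y)) // hermitian_formZl // rmorphM /=.
by rewrite -hermitian_formC.
Qed.

Lemma hermitian_form_diag_real H x : hermitian_form H -> H x x \is Num.real.
Proof. by move=> hH; apply/CrealP; rewrite -hermitian_formC. Qed.

Lemma hermitian_form_combination H G a b :
  hermitian_form H -> hermitian_form G -> a \is Num.real -> b \is Num.real ->
  hermitian_form (fun x y => a * H x y + b * G x y).
Proof.
move=> hH hG aR bR; apply/hermitian_formP; split=> [c x z y|x y].
  by rewrite !hermitian_form_linearl //; ring.
rewrite rmorphD !rmorphM /= (CrealP aR) (CrealP bR).
by rewrite -!hermitian_formC.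
Qed.

Definition selfadjoint (D : 'M[C]_2) H := forall x y, H (D *m x) y = H x (D *m y).

(** This turns the second membership condition in the definition of N_D into an
identity for H alone. *)
Lemma hermitian_form_twistP D H : hermitian_form H ->
  hermitian_form (fun x y => H x (D *m y)) <-> selfadjoint D H.
Proof.
move=> hH; split=> [hHD x y|sH].
  by rewrite (hermitian_formC y) // -(hermitian_formC y x hHD).
apply/hermitian_formP; split=> [c x z y|x y]; first exact: hermitian_form_linearl.
by rewrite -sH hermitian_formC.
Qed.

Lemma selfadjoint_twist D H : selfadjoint D H ->
  selfadjoint D (fun x y => H x (D *m y)).
Proof. by move=> sH x y /=; rewrite sH. Qed.

Lemma selfadjoint_combination D H G a b :
  selfadjoint D H -> selfadjoint D G ->
  selfadjoint D (fun x y => a * H x y + b * G x y).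
Proof. by move=> sH sG x y; rewrite sH sG. Qed.

Lemma Im_realM (r z : C) : r \is Num.real -> 'Im (r * z) = r * 'Im z.
Proof. by move=> rR; rewrite ImM (Creal_ReP _ rR) (Creal_ImP _ rR) mulr0 addr0. Qed.

Lemma selfadjoint_Im H (D : 'M[C]_2) (d : C) x y :
  hermitian_form H -> selfadjoint D H -> D *m D = d%:M -> d \is Num.real ->
  [/\ 'Im (H x x) = 0, 'Im (H y x) = - 'Im (H x y),
      'Im (H x (D *m x)) = 0, 'Im (H (D *m x) y) = 'Im (H x (D *m y)) &
      'Im (H x (D *m (D *m y))) = d * 'Im (H x y)].
Proof.
move=> hH sH hD dR; split.
- by apply/Creal_ImP; exact: hermitian_form_diag_real.
- by rewrite hermitian_formC // Im_conj.
- by apply/Creal_ImP/CrealP; rewrite -hermitian_formC // sH.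
- by rewrite sH.
- by rewrite mulmxA hD mul_scalar_mx hermitian_formZr // (CrealP dR) Im_realM.
Qed.

(** Since a + b D and c + e D commute and are self-adjoint for E = Im H, with E
alternating, the value is E(u, ((a + b D)(c' + e' D) - (a' + b' D)(c + e D)) v).
In particular it only involves E(u, v) and E(u, D v), with coefficients
that are integers if d and the coordinates are. *)
Lemma selfadjoint_Im_frame H (D : 'M[C]_2) (d : C) u v
    (a b c e a' b' c' e' : C) :
  hermitian_form H -> selfadjoint D H -> D *m D = d%:M ->
  all (mem Num.real) [:: d; a; b; c; e; a'; b'; c'; e'] ->
  'Im (H (a *: u + b *: (D *m u) + c *: v + e *: (D *m v))
         (a' *: u + b' *: (D *m u) + c' *: v + e' *: (D *m v))) =
  (a * c' + d * (b * e') - (a' * c + d * (b' * e))) * 'Im (H u v) +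
  (a * e' + b * c' - (a' * e + b' * c)) * 'Im (H u (D *m v)).
Proof.
move=> hH sH hD /= /and5P[dR aR bR cR /and5P[eR a'R b'R c'R /andP[e'R _]]].
have rel x y := selfadjoint_Im x y hH sH hD dR.
have diag x : 'Im (H x x) = 0 by case: (rel x x).
have anti x y : 'Im (H y x) = - 'Im (H x y) by case: (rel x y).
have diagD x : 'Im (H x (D *m x)) = 0 by case: (rel x x).
have adj x y : 'Im (H (D *m x) y) = 'Im (H x (D *m y)) by case: (rel x y).
have sq x y : 'Im (H x (D *m (D *m y))) = d * 'Im (H x y) by case: (rel x y).
rewrite !(hermitian_formDl, hermitian_formDr, hermitian_formZl, hermitian_formZr) //.
rewrite (CrealP a'R) (CrealP b'R) (CrealP c'R) (CrealP e'R) !raddfD /= !Im_realM //.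
rewrite !raddfD /= !Im_realM //.
rewrite !adj !sq !diagD !diag (anti u v) (anti (D *m u) v) adj.
ring.
Qed.

End HermitianAlgebra.

Section SelfadjointForms.
Variable C : numClosedFieldType.
Implicit Types (H G : 'cV[C]_2 -> 'cV[C]_2 -> C) (x y z : 'cV[C]_2).
Implicit Types (D : 'M[C]_2) (L : set 'cV[C]_2).

Definition real_frame D (l1 l2 : 'cV[C]_2) := forall x, exists a b c e : C,
  all (mem Num.real) [:: a; b; c; e] /\
  x = a *: l1 + b *: (D *m l1) + c *: l2 + e *: (D *m l2).

(** The two values determine Im H, and Im H determines H because
Re H(x, y) = Im H(i x, y). *)
Lemma selfadjoint_eq0 D (d : C) H l1 l2 :
  hermitian_form H -> selfadjoint D H -> D *m D = d%:M -> d \is Num.real ->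
  real_frame D l1 l2 -> 'Im (H l1 l2) = 0 -> 'Im (H l1 (D *m l2)) = 0 ->
  forall x y, H x y = 0.
Proof.
move=> hH sH hD dR frame h1 h2.
have ImH x y : 'Im (H x y) = 0.
  have [a [b [c [e [re ->]]]]] := frame x.
  have [a' [b' [c' [e' [re' ->]]]]] := frame y.
  rewrite (selfadjoint_Im_frame (d := d)) ?h1 ?h2 ?mulr0 ?addr0 //.
  case/and5P: re => aR bR cR eR _; case/and5P: re' => a'R b'R c'R e'R _.
  by apply/and5P; split=> //; apply/and5P; split=> //; apply/andP.
move=> x y; rewrite [LHS]Crect ImH mulr0 addr0 -ImMil.
by rewrite -hermitian_formZl // ImH.
Qed.

Definition average D (d : C) G x y : C := G (D *m x) (D *m y) + d * G x y.

(** Moving D from one argument to the other exchanges the two terms, since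
D^2 = d. *)
Lemma average_selfadjoint D (d : C) G :
  hermitian_form G -> D *m D = d%:M -> d \is Num.real ->
  hermitian_form (average D d G) /\ selfadjoint D (average D d G).
Proof.
move=> hG hD dR; split.
  apply/hermitian_formP; split=> [a x z y|x y]; rewrite /average.
    by rewrite mulmxDr -scalemxAr !hermitian_form_linearl //; ring.
  by rewrite rmorphD rmorphM /= (CrealP dR) -!hermitian_formC.
move=> x y; rewrite /average !(mulmxA D D) hD !mul_scalar_mx.
by rewrite hermitian_formZl // hermitian_formZr // (CrealP dR) addrC.
Qed.

Definition rank_one_form (u : 'rV[C]_2) x y : C :=
  (u *m x) 0 0 * ((u *m y) 0 0)^*.

Lemma rank_one_form_hermitian u : hermitian_form (rank_one_form u).
Proof.
apply/hermitian_formP; rewrite /rank_one_form; split=> [a x z y|x y].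
  by rewrite mulmxDr -scalemxAr !mxE; ring.
by rewrite rmorphM /= conjCK mulrC.
Qed.

Lemma exists_positive_definite_form :
  exists2 G : 'cV[C]_2 -> 'cV[C]_2 -> C, hermitian_form G & positive_definite G.
Proof.
exists (fun x y => 1 * rank_one_form (delta_mx 0 0) x y
                 + 1 * rank_one_form (delta_mx 0 1) x y).
  by apply: hermitian_form_combination; rewrite ?rpred1 //;
    exact: rank_one_form_hermitian.
move=> x x0; rewrite /rank_one_form !mul1r -!rowE !mxE -!normCK.
rewrite lt_neqAle addr_ge0 ?exprn_ge0 // andbT eq_sym.
rewrite paddr_eq0 ?exprn_ge0 // !expf_eq0 /= !normr_eq0.
apply: contra x0 => /andP[/eqP x0 /eqP x1]; apply/eqP/colP => i; rewrite mxE.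
by case: i => [[|[|//]]] lt_i; [rewrite -x0|rewrite -x1]; congr (x _ _); exact: val_inj.
Qed.

(** Three kernels suffice: those of the coordinate functions make D diagonal,
and that of their difference makes its diagonal entries equal. *)
Lemma scalar_mx_of_invariant_lines D :
  (forall (u : 'rV[C]_2) x, (u *m x) 0 0 = 0 -> (u *m (D *m x)) 0 0 = 0) ->
  is_scalar_mx D.
Proof.
move=> inv.
have D01 : D 0 1 = 0.
  have := inv (delta_mx 0 0) (delta_mx 1 0).
  by rewrite -!rowE -colE !mxE /=; exact.
have D10 : D 1 0 = 0.
  have := inv (delta_mx 0 1) (delta_mx 0 0).
  by rewrite -!rowE -colE !mxE /=; exact.
have D11 : D 1 1 = D 0 0.
  have := inv (delta_mx 0 0 - delta_mx 0 1) (const_mx 1).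
  rewrite !mulmxBl -!rowE !mxE !big_ord_recl !big_ord0 !mxE subrr => /(_ erefl).
  rewrite (_ : lift ord0 ord0 = 1); last exact: val_inj.
  rewrite (_ : (ord0 : 'I_2) = 0) // D01 D10 !mulr1 !addr0 add0r => /eqP.
  by rewrite subr_eq0 => /eqP.
apply/is_scalar_mxP; exists (D 0 0); apply/matrixP => i j; rewrite !mxE.
have I2 (k : 'I_2) : k = 0 \/ k = 1.
  by case: k => [[|[|//]]] lt_k; [left|right]; exact: val_inj.
by case: (I2 i) => ->; case: (I2 j) => -> //=; rewrite ?D01 ?D10 ?D11.
Qed.

(** For d > 0 average a positive definite form. Otherwise average the rank one
forms x, y |-> u(x) conj(u(y)): if all the averages vanished, their values at
(x, x) would show that u(x) = 0 implies u(Dx) = 0, for all functionals u. *)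
Lemma exists_selfadjoint_form D (d : C) :
  D *m D = d%:M -> d \is Num.real -> ~~ is_scalar_mx D ->
  exists H, [/\ hermitian_form H, selfadjoint D H,
    exists x y, H x y != 0 & 0 < d -> positive_definite H].
Proof.
move=> hD dR nsD.
have [d_gt0|d_ngt0] := boolP (0 < d).
  have [G hG pG] := exists_positive_definite_form.
  have [hH sH] := average_selfadjoint hG hD dR.
  have pH : positive_definite (average D d G).
    move=> x x0; rewrite /average ltr_wpDl //; last by rewrite mulr_gt0 ?pG.
    have [->|/pG/ltW//] := eqVneq (D *m x) 0.
    by rewrite hermitian_form0l.
  exists (average D d G); split => //.
  have x0 : const_mx 1 != 0 :> 'cV[C]_2.
    by apply/eqP => /matrixP/(_ 0 0)/eqP; rewrite !mxE oner_eq0.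
  by exists (const_mx 1), (const_mx 1); rewrite gt_eqF // pH.
apply: contrapT => no; case/negP: nsD; apply: scalar_mx_of_invariant_lines => u x ux.
have [hH sH] := average_selfadjoint (rank_one_form_hermitian u) hD dR.
have H0 : average D d (rank_one_form u) x x = 0.
  apply/eqP/negPn/negP => Hn; apply: no.
  exists (average D d (rank_one_form u)); split => //.
  by exists x, x.
move: H0; rewrite /average /rank_one_form ux mul0r mulr0 addr0 -normCK => /eqP.
by rewrite expf_eq0 /= normr_eq0 => /eqP.
Qed.

(** Completing the square: 2 u times the value of the form at (x, x) is
H(z, z) + (u^2 - d v^2) H(x, x), where z = u x + v D x. *)
Lemma positive_definite_combination D (d : C) H u v :
  hermitian_form H -> selfadjoint D H -> positive_definite H ->
  D *m D = d%:M -> d \is Num.real -> u \is Num.real -> v \is Num.real ->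
  0 < u -> d * v ^+ 2 < u ^+ 2 ->
  positive_definite (fun x y => u * H x y + v * H x (D *m y)).
Proof.
move=> hH sH pH hD dR uR vR u0 duv x x0.
have Hge0 y : 0 <= H y y.
  by have [->|/pH/ltW//] := eqVneq y 0; rewrite hermitian_form0l.
have sqE : H (u *: x + v *: (D *m x)) (u *: x + v *: (D *m x))
    + (u ^+ 2 - d * v ^+ 2) * H x x
    = (u *+ 2) * (u * H x x + v * H x (D *m x)).
  rewrite !(hermitian_formDl, hermitian_formDr, hermitian_formZl,
    hermitian_formZr) // !sH mulmxA hD mul_scalar_mx hermitian_formZr //.
  by rewrite (CrealP dR) (CrealP uR) (CrealP vR); ring.
rewrite -(pmulr_rgt0 _ (_ : 0 < u *+ 2)) ?pmulrn_lgt0 // -sqE.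
by rewrite ltr_wpDl // mulr_gt0 ?subr_gt0 ?pH.
Qed.

Lemma N_DP L D H : (forall x, L x -> L (D *m x)) ->
  N_D L D H <-> [/\ hermitian_form H, selfadjoint D H &
    forall x y, L x -> L y -> exists k : int, 'Im (H x y) = k%:~R].
Proof.
move=> hDL; split=> [[[hH iH] [/(hermitian_form_twistP _ hH) sH _]]|[hH sH iH]].
  by [].
split; split=> //; first exact/hermitian_form_twistP.
by move=> x y Lx Ly; apply: iH => //; exact: hDL.
Qed.

Lemma N_D0 L D : (forall x, L x -> L (D *m x)) -> N_D L D 0.
Proof.
move=> hDL; apply/N_DP => //; split=> // [|x y _ _].
  apply/hermitian_formP; split=> [a x z y|x y].
    by rewrite /GRing.zero /= mulr0 addr0.
  by rewrite /GRing.zero /= conjC0.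
by exists 0; rewrite /GRing.zero /= raddf0.
Qed.

Lemma N_DB L D H G : (forall x, L x -> L (D *m x)) ->
  N_D L D H -> N_D L D G -> N_D L D (H - G).
Proof.
move=> hDL /(N_DP _ hDL)[hH sH iH] /(N_DP _ hDL)[hG sG iG].
have -> : H - G = (fun x y => 1 * H x y + (-1) * G x y).
  by apply/funext => x; apply/funext => y; rewrite mul1r mulN1r.
apply/N_DP => //; split.
- by apply: hermitian_form_combination; rewrite ?rpredN ?rpred1.
- exact: selfadjoint_combination.
move=> x y Lx Ly; have [k kE] := iH x y Lx Ly; have [l lE] := iG x y Lx Ly.
by exists (k - l); rewrite mul1r mulN1r raddfB /= kE lE intrB.
Qed.

Lemma N_D_twist L D H : (forall x, L x -> L (D *m x)) ->
  N_D L D H -> N_D L D (fun x y => H x (D *m y)).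
Proof.
move=> hDL /(N_DP _ hDL)[hH sH iH]; apply/N_DP => //; split.
- exact/hermitian_form_twistP.
- exact: selfadjoint_twist.
by move=> x y Lx Ly; apply: iH => //; exact: hDL.
Qed.

End SelfadjointForms.

(** * Self-adjoint integral forms in a frame *)

(** For p and q the two values of Im H, the form H(x, Dy) takes the values q and
d p, and d p^2 - q^2 is the determinant of this pair of vectors. If it vanishes
with H nonzero, the forms H(x, Dy) and (q / p) H(x, y) take the same two values,
hence they are equal. *)
Lemma twist_norm_neq0 (C : numClosedFieldType) (D : 'M[C]_2) (d : C)
    (l1 l2 : 'cV[C]_2) (H : 'cV[C]_2 -> 'cV[C]_2 -> C) :
  D *m D = d%:M -> d \is Num.real -> d != 0 -> ~~ is_scalar_mx D ->
  real_frame D l1 l2 ->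
  hermitian_form H -> selfadjoint D H -> (exists x y, H x y != 0) ->
  (0 < d -> positive_definite H) ->
  d * 'Im (H l1 l2) ^+ 2 - 'Im (H l1 (D *m l2)) ^+ 2 != 0.
Proof.
move=> hD dR dn0 nsD frame hH sH [x [y Hxy]] pH.
set p := 'Im (H l1 l2); set q := 'Im (H l1 _).
have pR : p \is Num.real by exact: Creal_Im.
have qR : q \is Num.real by exact: Creal_Im.
apply/eqP => /subr0_eq dp2.
have [p0|pn0] := eqVneq p 0.
  have q0 : q = 0.
    by move/eqP: dp2; rewrite p0 expr0n mulr0 eq_sym expf_eq0 /= => /eqP.
  by case/eqP: Hxy; exact: (selfadjoint_eq0 hH sH hD dR frame).
(* r is a real square root of d, so that d > 0 and H is definite *)
pose r := q / p.
have rR : r \is Num.real by rewrite realM ?realV.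
have r2 : r ^+ 2 = d by rewrite /r expr_div_n -dp2 mulfK ?expf_neq0.
have d_gt0 : 0 < d.
  by rewrite lt_neqAle eq_sym dn0 -r2 real_exprn_even_ge0.
pose G x y : C := 1 * H x (D *m y) + (- r) * H x y.
have hG : hermitian_form G.
  apply: hermitian_form_combination => //; rewrite ?rpredN ?rpred1 //.
  exact/hermitian_form_twistP.
have sG : selfadjoint D G.
  by apply: selfadjoint_combination => //; exact: selfadjoint_twist.
have [_ _ _ _ sq] := selfadjoint_Im l1 l2 hH sH hD dR.
have G0 : forall x y, G x y = 0.
  apply: (selfadjoint_eq0 hG sG hD dR frame).
    rewrite /G mul1r raddfD /= Im_realM ?rpredN // -/p -/q.
    by rewrite /r mulNr mulfVK // subrr.
  rewrite /G mul1r raddfD /= Im_realM ?rpredN // sq -/p -/q.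
  by rewrite mulNr -r2 /r expr2 -!mulrA mulVf // mulr1 mulrC subrr.
case/negP: nsD; apply/is_scalar_mxP; exists r; apply/subr0_eq/matrixP => i j.
pose z := (D - r%:M) *m delta_mx j 0 : 'cV[C]_2.
suff z0 : z = 0.
  by have := congr1 (fun w : 'cV_2 => w i 0) z0; rewrite /z -colE !mxE.
apply/eqP/negPn/negP => /(pH d_gt0).
rewrite {2}/z mulmxBl mul_scalar_mx -scaleNr hermitian_formDr //.
rewrite hermitian_formZr // (CrealP _) ?rpredN //.
by have := G0 z (delta_mx j 0); rewrite /G mul1r => ->; rewrite ltxx.
Qed.

Section NeronSeveriOfFrame.
Variables (C : numClosedFieldType) (L : set 'cV[C]_2) (D : 'M[C]_2) (d : int).
Variables (l1 l2 : 'cV[C]_2) (N : nat).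
Hypotheses (hDL : forall x, L x -> L (D *m x)) (hD : D *m D = (d%:~R)%:M).
Hypotheses (nsD : ~~ is_scalar_mx D) (d_neq0 : d != 0).
Hypotheses (Ll1 : L l1) (Ll2 : L l2) (frame : real_frame D l1 l2).
Hypotheses (N_gt0 : (0 < N)%N)
  (N_frame : forall x, L x -> exists a b c e : int, N%:R *: x =
     a%:~R *: l1 + b%:~R *: (D *m l1) + c%:~R *: l2 + e%:~R *: (D *m l2)).
Implicit Types (H G : 'cV[C]_2 -> 'cV[C]_2 -> C) (x y : 'cV[C]_2).

(** On vectors N x and N y, with x and y in the lattice, Im H is an integral
multiple of N^2. *)
Lemma N_D_criterion H : hermitian_form H -> selfadjoint D H ->
  'Im (H l1 l2) = N%:R ^+ 2 -> 'Im (H l1 (D *m l2)) = 0 -> N_D L D H.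
Proof.
move=> hH sH Ha Hb; apply/N_DP => //; split=> // x y Lx Ly.
have [a [b [c [e xE]]]] := N_frame Lx.
have [a' [b' [c' [e' yE]]]] := N_frame Ly.
have NH : 'Im (H (N%:R *: x) (N%:R *: y)) = N%:R ^+ 2 * 'Im (H x y).
  rewrite hermitian_formZl // hermitian_formZr // conjC_nat mulrA -expr2.
  by rewrite Im_realM ?rpredX ?realn.
move: NH; rewrite xE yE (selfadjoint_Im_frame (d := d%:~R)) //=; last first.
  by rewrite !realz.
rewrite Ha Hb mulr0 addr0 mulrC => /mulfI/esym -> //.
  exists (a * c' + d * (b * e') - (a' * c + d * (b' * e))).
  by rewrite !(intrB, intrD, intrM).
by rewrite expf_neq0 // pnatr_eq0 -lt0n.
Qed.

(** K is kept in the form u H(x, y) + v H(x, Dy) because the sign of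
u^2 - d v^2 decides whether K is definite. *)
Lemma exists_N_D : exists H u v,
  [/\ hermitian_form H, selfadjoint D H, 0 < d -> positive_definite H,
      [/\ u \is Num.real, v \is Num.real & u ^+ 2 - d%:~R * v ^+ 2 != 0] &
      let K x y := u * H x y + v * H x (D *m y) in
      [/\ N_D L D K, 'Im (K l1 l2) = N%:R ^+ 2 & 'Im (K l1 (D *m l2)) = 0]].
Proof.
have dR : (d%:~R : C) \is Num.real by exact: realz.
have dC0 : (d%:~R : C) != 0 by rewrite intr_eq0.
have [H [hH sH Hn0 pH]] := exists_selfadjoint_form hD dR nsD.
have delta0 := twist_norm_neq0 hD dR dC0 nsD frame hH sH Hn0 pH.
have [_ _ _ _ sq] := selfadjoint_Im l1 l2 hH sH hD dR.
move: delta0 sq; set p := 'Im (H l1 l2); set q := 'Im (H l1 _).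
set delta := _ - _ => delta0 sq.
have pR : p \is Num.real by exact: Creal_Im.
have qR : q \is Num.real by exact: Creal_Im.
have deltaR : delta \is Num.real by rewrite realB ?realM ?rpredX.
have N2R : (N%:R ^+ 2 : C) \is Num.real by rewrite rpredX ?realn.
have N20 : (N%:R ^+ 2 : C) != 0 by rewrite expf_neq0 // pnatr_eq0 -lt0n.
(* the solution of u p + v q = N^2, u q + v d p = 0 *)
pose u := N%:R ^+ 2 * (d%:~R * p) / delta; pose v := - (N%:R ^+ 2 * q) / delta.
have uR : u \is Num.real by rewrite !(realM, realV).
have vR : v \is Num.real by rewrite !(realM, realV, realN).
exists H, u, v; split => //.
- by move=> d0; apply: pH; rewrite ltr0z.
- split=> //.
  have -> : u ^+ 2 - d%:~R * v ^+ 2 = (N%:R ^+ 2) ^+ 2 * d%:~R / delta.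
    by rewrite /u /v; move: delta0; rewrite /delta => delta0; field.
  by rewrite mulf_neq0 ?invr_neq0 // mulf_neq0 // expf_neq0.
move=> K.
have K1 : 'Im (K l1 l2) = N%:R ^+ 2.
  rewrite /K raddfD /= !Im_realM // -/p -/q /u /v.
  by move: delta0; rewrite /delta => delta0; field.
have K2 : 'Im (K l1 (D *m l2)) = 0.
  rewrite /K raddfD /= !Im_realM // sq -/p -/q /u /v.
  by move: delta0; rewrite /delta => delta0; field.
split=> //; apply: N_D_criterion => //.
  by apply: hermitian_form_combination => //; exact/hermitian_form_twistP.
by apply: selfadjoint_combination => //; exact: selfadjoint_twist.
Qed.

(** Apply [rank_two_subgroup] to the values of Im H at (l1, l2) and (l1, D l2):
on K they are N^2 and 0, on K(x, Dy) they are 0 and d N^2. *)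
Lemma N_D_iso_Z2 : iso_Zn 2 (N_D L D).
Proof.
have dR : (d%:~R : C) \is Num.real by exact: realz.
pose ev w (H : 'cV[C]_2 -> 'cV[C]_2 -> C) : C := 'Im (H l1 w).
have ev_add w : zmod_morphism (ev w) by move=> H G; rewrite /ev raddfB.
pose evM w := GRing.isZmodMorphism.Build _ _ (ev w) (ev_add w).
pose evA w : {additive ('cV[C]_2 -> 'cV[C]_2 -> C) -> C} := HB.pack (ev w) (evM w).
have [H [u [v [hH sH _ _ [NDK K1 K2]]]]] := exists_N_D.
set K := fun x y => _ in NDK K1 K2.
have [hK sK _] := (N_DP _ hDL).1 NDK.
have N20 : (N%:R ^+ 2 : C) != 0 by rewrite expf_neq0 // pnatr_eq0 -lt0n.
apply: (@rank_two_subgroup _ _ _ (evA l2) (evA (D *m l2))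
  K (fun x y => K x (D *m y))).
- exact: N_D0.
- by move=> G G'; exact: N_DB.
- by move=> G /(N_DP _ hDL)[_ _]; exact.
- by move=> G /(N_DP _ hDL)[_ _ iG]; apply: iG => //; exact: hDL.
- move=> G /(N_DP _ hDL)[hG sG _] G1 G2; apply/funext => x; apply/funext => y.
  exact: (selfadjoint_eq0 hG sG hD dR frame).
- exact: NDK.
- exact: N_D_twist.
have [_ _ _ _ sq] := selfadjoint_Im l1 l2 hK sK hD dR.
by rewrite /= /ev K1 K2 sq K1 mulr0 subr0 mulf_neq0 // mulf_neq0 // intr_eq0.
Qed.

Lemma N_D_positive_definite : 0 < d ->
  exists2 H, N_D L D H & positive_definite H.
Proof.
move=> d_gt0; have dR : (d%:~R : C) \is Num.real by exact: realz.
have dC_gt0 : 0 < (d%:~R : C) by rewrite ltr0z.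
have [H [u [v [hH sH /(_ d_gt0) pH [uR vR w0] [NDK _ _]]]]] := exists_N_D.
have {u v uR vR w0 NDK} [u [v [uR vR w NDK]]] : exists u v,
    [/\ u \is Num.real, v \is Num.real, d%:~R * v ^+ 2 < u ^+ 2 &
    N_D L D (fun x y => u * H x y + v * H x (D *m y))].
  have wR : u ^+ 2 - d%:~R * v ^+ 2 \is Num.real by rewrite realB ?realM ?rpredX.
  move: w0; rewrite real_neqr_lt ?real0 // => /orP[w_lt0|]; last first.
    by rewrite subr_gt0 => w; exists u, v.
  (* twisting K by D multiplies the norm u^2 - d v^2 by - d *)
  exists (d%:~R * v), u; split => //; first by rewrite realM.
    rewrite exprMn expr2 -mulrA ltr_pM2l // -subr_gt0 -opprB oppr_gt0.
    exact: w_lt0.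
  have := N_D_twist hDL NDK; congr (N_D L D _).
  apply/funext => x; apply/funext => y.
  rewrite mulmxA hD mul_scalar_mx hermitian_formZr // (CrealP dR); ring.
have u0 : u != 0.
  apply: contraTneq w => ->; rewrite expr0n /= -real_leNgt ?real0 ?realM ?rpredX //.
  by rewrite mulr_ge0 ?(ltW dC_gt0) // real_exprn_even_ge0.
move: u0; rewrite real_neqr_lt ?real0 // => /orP[u_lt0|u_gt0].
  exists (0 - (fun x y => u * H x y + v * H x (D *m y))).
    by apply: N_DB => //; exact: N_D0.
  have -> : 0 - (fun x y => u * H x y + v * H x (D *m y)) =
      (fun x y => (- u) * H x y + (- v) * H x (D *m y)).
    by rewrite sub0r; apply/funext => x; apply/funext => y; rewrite !mulNr -opprD.
  apply: (positive_definite_combination hH sH pH hD); rewrite ?rpredN //.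
    by rewrite oppr_gt0.
  by rewrite !sqrrN.
exists (fun x y => u * H x y + v * H x (D *m y)) => //.
exact: (positive_definite_combination hH sH pH hD).
Qed.

Lemma N_D_not_positive_definite : d < 0 ->
  ~ exists2 H, N_D L D H & positive_definite H.
Proof.
move=> d_lt0 [H /(N_DP _ hDL)[hH sH _] pH].
have x0 : const_mx 1 != 0 :> 'cV[C]_2.
  by apply/eqP => /matrixP/(_ 0 0)/eqP; rewrite !mxE oner_eq0.
have DDx : D *m (D *m const_mx 1) = d%:~R *: const_mx 1 :> 'cV[C]_2.
  by rewrite mulmxA hD mul_scalar_mx.
have Dx0 : D *m const_mx 1 != 0 :> 'cV[C]_2.
  apply: contra x0 => /eqP Dx; move: DDx; rewrite Dx mulmx0 => /esym/eqP.
  by rewrite scaler_eq0 intr_eq0 (negPf d_neq0).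
have := pH _ Dx0; rewrite sH DDx hermitian_formZr // rmorph_int.
by rewrite nmulr_rgt0 ?ltrz0 // lt_gtF // pH.
Qed.

End NeronSeveriOfFrame.

(** * Discrete subgroups *)

(** Dirichlet's pigeonhole argument: cut [0, 1[^k into (B + 1)^k cells of side
1 / (B + 1) < eps; among the fractional parts of t c for (B + 1)^k + 1 values of
t, two lie in the same cell. *)
Lemma simultaneous_approximation (R : archiRealFieldType) (k : nat)
    (c : 'I_k -> R) (eps : R) : 0 < eps ->
  exists (n : nat) (m : 'I_k -> int), (0 < n)%N /\
    forall j, `|n%:R * c j - (m j)%:~R| < eps.
Proof.
move=> eps_gt0.
pose B := Num.bound eps^-1.
have B_gt : eps^-1 < B.+1%:R.
  apply: (lt_trans (archi_boundP _)); first by rewrite invr_ge0 ltW.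
  by rewrite ltr_nat.
pose x (t : nat) j := t%:R * c j - (Num.floor (t%:R * c j))%:~R.
have x_itv t j : 0 <= x t j < 1.
  by have := floor_itv (t%:R * c j); rewrite /x intrD; lra.
pose cell (t : 'I_(B.+1 ^ k).+1) : {ffun 'I_k -> 'I_B.+1} :=
  [ffun j => inord (Num.truncn (B.+1%:R * x t j))].
have cellP t j : (cell t j)%:R <= B.+1%:R * x t j < (cell t j).+1%:R.
  have /andP[x0 x1] := x_itv t j.
  have Bx0 : 0 <= B.+1%:R * x t j by rewrite mulr_ge0.
  have tr := trunc_itv Bx0; rewrite ffunE inordK // -(ltr_nat R).
  case/andP: tr => le _; apply: le_lt_trans le _.
  by rewrite -[ltRHS]mulr1 ltr_pM2l.
have : ~~ injectiveb cell.
  apply/negP => /injectiveP /leq_card.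
  by rewrite card_ffun !card_ord ltnn.
case/injectivePn => t [t' tt' eq_cell].
wlog lt_tt' : t t' tt' eq_cell / (t < t')%N.
  move=> wl; have [?|?|/val_inj/eqP] := ltngtP t t'; [exact: wl tt' _ _| |].
    by apply: (wl t' t); rewrite // eq_sym.
  by rewrite (negPf tt').
exists (t' - t)%N, (fun j => Num.floor (t'%:R * c j) - Num.floor (t%:R * c j)).
split; first by rewrite subn_gt0.
move=> j; rewrite natrB ?(ltnW lt_tt') // intrB.
have -> : (t'%:R - t%:R) * c j -
    ((Num.floor (t'%:R * c j))%:~R - (Num.floor (t%:R * c j))%:~R) =
    x t' j - x t j by rewrite /x; ring.
have := cellP t j; have := cellP t' j; rewrite -eq_cell -[(cell t j).+1%:R]natr1.
move: (cell t j)%:R => q Ht' Ht.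
have B0 : (0 : R) < B.+1%:R by rewrite ltr0n.
have H : B.+1%:R * `|x t' j - x t j| < 1.
  rewrite -[X in X * _](gtr0_norm B0) -normrM ltr_norml mulrBr; lra.
have H1 : 1 < B.+1%:R * eps by rewrite -ltr_pdivrMr // mul1r.
by rewrite -(ltr_pM2l B0); apply: lt_trans H1.
Qed.

Section DiscreteSubgroups.
Local Open Scope complex_scope.

(** If n c is close to the integral vector m, then n v - \sum_j m_j f_j is a small
element of L, hence zero. *)
Lemma discrete_real_combination (R : realType) (V : normedModType R[i])
    (L : set V) (k : nat) (c : 'I_k -> R) (f : 'I_k -> V) :
  isolated L 0 -> (forall x y, L x -> L y -> L (x - y)) ->
  (forall j, L (f j)) -> L (\sum_j (c j)%:C *: f j) ->
  exists (n : nat) (m : 'I_k -> int),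
    [/\ (0 < n)%N, forall j, `|n%:R * c j - (m j)%:~R| < 1 &
    (\sum_j (c j)%:C *: f j) *+ n = \sum_j f j *~ m j].
Proof.
move=> [/set_mem L0 [U /nbhs_ballP[e /= e0 eU] UL]] LB Lf Lv.
have LN x : L x -> L (- x) by move=> Lx; rewrite -sub0r; exact: LB.
have LD x y : L x -> L y -> L (x + y).
  by move=> Lx Ly; rewrite -[y]opprK; apply: LB => //; exact: LN.
have LM x z : L x -> L (x *~ z) by exact: subgroup_mulrz.
have small y : L y -> `|y| < e -> y = 0.
  move=> Ly ye; suff: (U `&` L) y by rewrite UL.
  by split=> //; apply: eU; rewrite -ball_normE /= sub0r normrN.
pose S := \sum_j `|f j| + 1.
have S0 : 0 < S by rewrite ltr_wpDl // sumr_ge0.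
(* eps is the real number e / S: positive elements of R[i] are real *)
have eS0 : 0 < e / S by rewrite divr_gt0.
pose eps := complex.Re (e / S).
have epsE : eps%:C = e / S by rewrite RRe_real // gtr0_real.
have eps0 : 0 < eps by rewrite -ltcR epsE.
have eps1_gt0 : 0 < Num.min eps 1 by rewrite lt_min eps0 ltr01.
have [n [m [n0 nm1]]] := @simultaneous_approximation R k c _ eps1_gt0.
have nm j : `|n%:R * c j - (m j)%:~R| < eps.
  by have := nm1 j; rewrite lt_min => /andP[].
exists n, m; split => // [j|]; first by have := nm1 j; rewrite lt_min => /andP[].
apply/subr0_eq/small.
  apply: LB; first by rewrite pmulrn; exact: LM.
  by elim/big_ind: _ => // j _; exact: LM.
rewrite -sumrMnl -sumrB.
apply: le_lt_trans (ler_norm_sum _ _ _) _.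
have -> : e = eps%:C * S by rewrite epsE mulfVK // gt_eqF.
rewrite mulrDr mulr1 mulr_sumr.
apply: (@le_lt_trans _ _ (\sum_j eps%:C * `|f j|)); last by rewrite ltrDl ltcR.
apply: ler_sum => j _.
rewrite -scaler_nat -[f j *~ _]scaler_int scalerA -scalerBl normrZ ler_wpM2r //.
have -> : n%:R * (c j)%:C - (m j)%:~R = (n%:R * c j - (m j)%:~R)%:C.
  by rewrite rmorphB rmorphM rmorph_nat rmorph_int.
by rewrite normc_def /= expr0n addr0 sqrtr_sqr lecR ltW.
Qed.

(** After scaling a relation so that c_j = 1, apply the approximation to the
vector 0: the bound |n c_j - m_j| < 1 forces m_j = n > 0. *)
Lemma discrete_free (R : realType) (V : normedModType R[i])
    (L : set V) (k : nat) (f : 'I_k -> V) :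
  isolated L 0 -> (forall x y, L x -> L y -> L (x - y)) ->
  (forall j, L (f j)) ->
  (forall m : 'I_k -> int, \sum_j f j *~ m j = 0 -> forall j, m j = 0) ->
  forall c : 'I_k -> R, \sum_j (c j)%:C *: f j = 0 -> forall j, c j = 0.
Proof.
move=> L0 LB Lf Zfree c c0 j; apply/eqP/negPn/negP => cj.
pose b i := (c j)^-1 * c i.
have bE : \sum_i (b i)%:C *: f i = 0.
  under eq_bigr => i _ do rewrite rmorphM /= -scalerA.
  by rewrite -scaler_sumr c0 scaler0.
have [|n [m [n0 nm]]] := @discrete_real_combination R V L k b f L0 LB Lf.
  by rewrite bE; case: L0 => /set_mem.
rewrite bE mul0rn => /esym/Zfree/(_ j) mj.
have := nm j; rewrite mj subr0 /b mulVf // mulr1 normr_nat ltrn1.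
by rewrite ltnNge n0.
Qed.

End DiscreteSubgroups.

(** * Real coordinates *)

Section RealCoordinates.
Local Open Scope complex_scope.
Variable R : realType.
Implicit Types (x y : 'cV[R[i]]_2).

Definition real_coords x : 'rV[R]_4 :=
  \row_j [tuple complex.Re (x 0 0); complex.Im (x 0 0);
                complex.Re (x 1 0); complex.Im (x 1 0)]`_j.

Lemma real_coords_inj : injective real_coords.
Proof.
move=> x y /rowP exy; apply/colP => i.
have := (exy 0, exy 1, exy 2, exy 3); rewrite !mxE /= => -[[[re0 im0] re1] im1].
have I2 : i = 0 \/ i = 1.
  by case: i => [[|[|//]]] lt_i; [left|right]; exact: val_inj.
by case: I2 => ->; apply/eqP; rewrite eq_complex ?re0 ?re1 ?im0 ?im1 !eqxx.
Qed.

Lemma real_coords_combination k (c : 'I_k -> R) (f : 'I_k -> 'cV[R[i]]_2) :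
  real_coords (\sum_j (c j)%:C *: f j) =
  (\row_j c j) *m (\matrix_j real_coords (f j)).
Proof.
have ReZ (a : R) (z : R[i]) : complex.Re (a%:C * z) = a * complex.Re z.
  by case: z => re im /=; rewrite mul0r subr0.
have ImZ (a : R) (z : R[i]) : complex.Im (a%:C * z) = a * complex.Im z.
  by case: z => re im /=; rewrite mul0r addr0.
have sumRe (i : 'I_2) : complex.Re ((\sum_j (c j)%:C *: f j) i 0) =
   \sum_j c j * complex.Re (f j i 0).
  by rewrite summxE raddf_sum; apply: eq_bigr => j _; rewrite !mxE; exact: ReZ.
have sumIm (i : 'I_2) : complex.Im ((\sum_j (c j)%:C *: f j) i 0) =
   \sum_j c j * complex.Im (f j i 0).
  by rewrite summxE raddf_sum; apply: eq_bigr => j _; rewrite !mxE; exact: ImZ.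
apply/rowP => l; rewrite [RHS]mxE.
rewrite (eq_bigr (fun j => c j * real_coords (f j) 0 l)); last first.
  by move=> j _; rewrite !mxE.
rewrite mxE; under [RHS]eq_bigr => j _ do rewrite mxE.
by case: l => [[|[|[|[|//]]]] lt_l] /=; rewrite ?sumRe ?sumIm.
Qed.

Definition real_free k (f : 'I_k -> 'cV[R[i]]_2) :=
  forall c : 'I_k -> R, \sum_j (c j)%:C *: f j = 0 -> forall j, c j = 0.

Lemma real_free_coords k (f : 'I_k -> 'cV[R[i]]_2) :
  real_free f -> row_free (\matrix_j real_coords (f j)).
Proof.
move=> free_f; rewrite -kermx_eq0; apply/eqP/row_matrixP => i; rewrite row0.
set w := row i _.
have wM : w *m (\matrix_j real_coords (f j)) = 0.
  by apply/eqP; rewrite /w -row_mul mulmx_ker row0.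
have w0 : w = 0.
  apply/rowP => j; rewrite [RHS]mxE; apply: (free_f (fun j => w 0 j)).
  apply: real_coords_inj; rewrite real_coords_combination.
  rewrite (_ : \row_j w 0 j = w) ?wM; last by apply/rowP => l; rewrite mxE.
  by apply/rowP => l; rewrite !mxE; case: l => [[|[|[|[|//]]]] lt_l].
by [].
Qed.

Lemma real_free_span (f : 'I_4 -> 'cV[R[i]]_2) x :
  real_free f -> exists c : 'I_4 -> R, x = \sum_j (c j)%:C *: f j.
Proof.
move=> /real_free_coords free_f.
have : (real_coords x <= \matrix_j real_coords (f j))%MS.
  by apply: submx_full; rewrite /row_full; exact: free_f.
case/submxP => c xE; exists (fun j => c 0 j); apply: real_coords_inj.
rewrite real_coords_combination xE; congr (_ *m _).
by apply/rowP => j; rewrite mxE.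
Qed.

(** Four real-independent vectors cannot lie in a real plane. *)
Lemma exists_outside_real_span (f : 'I_4 -> 'cV[R[i]]_2) (u v : 'cV[R[i]]_2) :
  real_free f ->
  exists i, forall a b : R, f i <> a%:C *: u + b%:C *: v.
Proof.
move=> /real_free_coords free_f; apply: contrapT => no.
pose g (j : 'I_2) := if j == 0 then u else v.
suff: (\matrix_j real_coords (f j) <= \matrix_j real_coords (g j))%MS.
  move/mxrankS; rewrite (eqP free_f) => /leq_trans/(_ (rank_leq_row _)).
  by [].
apply/row_subP => i; rewrite rowK.
have [a [b fi]] : exists a b : R, f i = a%:C *: u + b%:C *: v.
  apply: contrapT => no_i; apply: no; exists i => a b fi.
  by apply: no_i; exists a, b.
rewrite (_ : f i = \sum_j ((\row_j if j == 0 then a else b) 0 j)%:C *: g j).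
  by rewrite real_coords_combination submxMl.
by rewrite !big_ord_recl big_ord0 addr0 !mxE.
Qed.

End RealCoordinates.

(** * Frames of lattices *)

Lemma nonsquare_norm_eq0 (d a b : int) :
  (forall n : int, d != n ^+ 2) -> a ^+ 2 = d * b ^+ 2 -> a = 0 /\ b = 0.
Proof.
move=> hd ab; have [b0|bn0] := eqVneq b 0.
  by split=> //; apply/eqP; move/eqP: ab; rewrite b0 expr0n mulr0 expf_eq0.
have /dvdzP[k ak] : (b %| a)%Z.
  by rewrite dvdzE -(@dvdn_pexp2r _ _ 2) // -!abszX -dvdzE ab dvdz_mull.
case/eqP: (hd k); apply: (mulIf (expf_neq0 2 bn0)).
by rewrite -ab ak exprMn.
Qed.

(** The plane over K as a normed module: its topology is the one in which a lattice is
required to be discrete. *)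
Definition plane (K : numClosedFieldType) : normedModType K := 'cV[K]_2.

Section LatticeFrame.
Local Open Scope complex_scope.
Variables (R : realType) (L : set 'cV[R[i]]_2) (D : 'M[R[i]]_2) (d : int).
Hypotheses (hd : forall n : int, d != n ^+ 2) (hD : D *m D = (d%:~R)%:M).

Definition frame4 (l1 l2 : 'cV[R[i]]_2) (j : 'I_4) : 'cV[R[i]]_2 :=
  [tuple l1; D *m l1; l2; D *m l2]`_j.

Lemma sum_frame4 (c : 'I_4 -> R[i]) l1 l2 :
  \sum_j c j *: frame4 l1 l2 j =
  c 0 *: l1 + c 1 *: (D *m l1) + c 2 *: l2 + c 3 *: (D *m l2).
Proof.
rewrite !big_ord_recl big_ord0 addr0 /frame4 /= !addrA.
by congr (_ *: _ + _ *: _ + _ *: _ + _ *: _); congr (c _); exact: val_inj.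
Qed.

(** Multiply the relation (a + b D) l1 + (c + e D) l2 = 0 by c - e D. *)
Lemma quadratic_norm (a b c e : R[i]) (l1 l2 : 'cV[R[i]]_2) :
  a *: l1 + b *: (D *m l1) + c *: l2 + e *: (D *m l2) = 0 ->
  (c ^+ 2 - d%:~R * e ^+ 2) *: l2 =
  (d%:~R * (e * b) - c * a) *: l1 + (e * a - c * b) *: (D *m l1).
Proof.
move=> rel; have := congr1 (mulmx D) rel; rewrite !mulmxDr -!scalemxAr mulmx0.
rewrite !mulmxA hD !mul_scalar_mx; move: rel.
move: (D *m l1) (D *m l2) => w1 w2 rel Drel.
apply/subr0_eq; transitivity
  (c *: (a *: l1 + b *: w1 + c *: l2 + e *: w2) -
   e *: (a *: w1 + b *: (d%:~R *: l1) + c *: w2 + e *: (d%:~R *: l2))).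
  by apply/colP => i; rewrite !mxE; ring.
by rewrite rel Drel !scaler0 subr0.
Qed.

(** A relation with (c, e) != 0 would place l2 in the real span of l1 and D l1,
since c^2 - d e^2 != 0; once c = e = 0, a relation with (a, b) != 0 would give
(a^2 - d b^2) l1 = 0. *)
Lemma frame4_int_free (l1 l2 : 'cV[R[i]]_2) (a b c e : int) : l1 != 0 ->
  (forall r s : R, l2 <> r%:C *: l1 + s%:C *: (D *m l1)) ->
  a%:~R *: l1 + b%:~R *: (D *m l1) + c%:~R *: l2 + e%:~R *: (D *m l2) = 0 ->
  [/\ a = 0, b = 0, c = 0 & e = 0].
Proof.
move=> l10 l2_out rel.
have [c0 e0] : c = 0 /\ e = 0.
  apply: (nonsquare_norm_eq0 hd); apply/eqP/negPn/negP; rewrite -subr_eq0 => s0.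
  set s := _ - _ in s0.
  apply: (l2_out ((d * (e * b) - c * a)%:~R / s%:~R)
                 ((e * a - c * b)%:~R / s%:~R)).
  have sC : s%:~R != 0 :> R[i] by rewrite intr_eq0.
  apply: (scalerI sC).
  rewrite scalerDr !scalerA !rmorphM !fmorphV !rmorph_int.
  rewrite ![s%:~R * _]mulrC !mulfVK //.
  have := quadratic_norm rel; rewrite /s.
  by rewrite !expr2 !(intrB, intrM).
have [a0 b0] : a = 0 /\ b = 0.
  apply: (nonsquare_norm_eq0 hd); apply/eqP; rewrite -subr_eq0.
  have rel' : 0%:~R *: l2 + 0%:~R *: (D *m l2) + a%:~R *: l1 + b%:~R *: (D *m l1) = 0.
    by move: rel; rewrite c0 e0 !scale0r !addr0 !add0r.
  have := quadratic_norm rel'; rewrite !mulr0 !subr0 !scale0r addr0 => /eqP.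
  rewrite scaler_eq0 (negPf l10) orbF -(@intr_eq0 R[i]).
  by rewrite !expr2 !(intrB, intrM).
by split.
Qed.

(** A basis of the lattice is real-independent by discreteness, so for l1 in it
some basis vector l2 lies outside the real span of l1 and D l1. Then
l1, D l1, l2, D l2 are independent over the integers, hence over the reals, and
a positive multiple of each basis vector is an integral combination of them. *)
Lemma lattice_frame : is_lattice L -> (forall x, L x -> L (D *m x)) ->
  exists l1 l2 N, [/\ L l1, L l2, real_frame D l1 l2, (0 < N)%N &
    forall x, L x -> exists a b c e : int, N%:R *: x =
     a%:~R *: l1 + b%:~R *: (D *m l1) + c%:~R *: l2 + e%:~R *: (D *m l2)].
Proof.
move=> [isoL [f [f_inj f_range]]] hDL.
have Lf w : L (f w) by rewrite -f_range; exists w.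
have L0 : L 0 by rewrite -(raddf0 f).
have LB x y : L x -> L y -> L (x - y).
  by rewrite -f_range => -[v _ <-] [w _ <-]; exists (v - w); rewrite ?raddfB.
have iso0 : @isolated (plane R[i]) L 0 by rewrite (isoL : @isolated (plane R[i]) L = L).
pose e (j : 'I_4) := f (delta_mx 0 j).
have fE w : f w = \sum_j e j *~ w 0 j.
  rewrite {1}(row_sum_delta w) raddf_sum; apply: eq_bigr => j _.
  by rewrite -[in LHS](intz (w 0 j)) scaler_int raddfMz.
have e_free : real_free e.
  apply: (discrete_free (V := plane R[i]) iso0 LB) => [j|m]; first exact: Lf.
  have -> : \sum_j e j *~ m j = f (\row_j m j).
    by rewrite fE; apply: eq_bigr => j _; rewrite mxE.
  rewrite -(raddf0 f) => /f_inj/rowP m0 j.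
  by have := m0 j; rewrite !mxE.
pose l1 := e 0.
have l1_neq0 : l1 != 0.
  apply/eqP; rewrite /l1 /e -(raddf0 f) => /f_inj/rowP/(_ 0).
  by rewrite !mxE.
have [i l2_out] := exists_outside_real_span l1 (D *m l1) e_free.
pose l2 := e i; pose g := frame4 l1 l2.
have Lg j : L (g j).
  have Ll1 : L l1 by exact: Lf.
  have Ll2 : L l2 by exact: Lf.
  by case: j => [[|[|[|[|//]]]] lt_j]; rewrite /g /frame4 //=; exact: hDL.
have g_free : real_free g.
  apply: (discrete_free (V := plane R[i]) iso0 LB Lg) => m.
  under eq_bigr => j _ do rewrite -scaler_int.
  rewrite (sum_frame4 (fun j => (m j)%:~R)).
  case/(frame4_int_free l1_neq0 l2_out) => m0 m1 m2 m3 j.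
  have : j \in [:: 0; 1; 2; 3] by case: j => [[|[|[|[|//]]]] lt_j].
  by rewrite !inE => /or4P[]/eqP ->.
exists l1, l2.
pose Q y := exists m : 'I_4 -> int, y = \sum_l g l *~ m l.
have e_mult j : exists n, (0 < n)%N /\ Q (e j *+ n).
  have [c ec] := real_free_span (e j) g_free.
  have [|n [m [n0 _ nm]]] :=
    discrete_real_combination (V := plane R[i]) (c := c) iso0 LB Lg.
    by rewrite -ec; exact: Lf.
  by exists n; split=> //; exists m; rewrite ec.
have [n nP] := choice e_mult.
have QD y z : Q y -> Q z -> Q (y + z).
  move=> [m ->] [m' ->]; exists (fun l => m l + m' l).
  by rewrite -big_split; apply: eq_bigr => l _; rewrite mulrzDr.
have Q0 : Q 0 by exists (fun=> 0); rewrite big1 // => l _; rewrite mulr0z.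
have QM y k : Q y -> Q (y *~ k).
  move=> [m ->]; exists (fun l => m l * k).
  by rewrite mulrz_suml; apply: eq_bigr => l _; rewrite mulrzA.
pose N := (\prod_j n j)%N; exists N; split.
- exact: Lf.
- exact: Lf.
- move=> x; have [c xE] := real_free_span x g_free.
  exists (c 0)%:C, (c 1)%:C, (c 2)%:C, (c 3)%:C; split.
    by apply/allP => z; rewrite !inE => /or4P[]/eqP -> /=; rewrite realE !lecR -realE num_real.
  by rewrite xE (sum_frame4 (fun j => (c j)%:C)).
- by rewrite prodn_gt0 // => j; case: (nP j).
move=> x; rewrite -f_range => -[w _ <-].
have [m NE] : Q (N%:R *: f w).
  rewrite fE scaler_nat -sumrMnl; elim/big_ind: _ => // j _.
  rewrite pmulrn -mulrzA mulrC mulrzA; apply: (QM).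
  by rewrite /N (bigD1 j) //= PoszM mulrzA; apply: (QM); rewrite -pmulrn; case: (nP j).
exists (m 0), (m 1), (m 2), (m 3); rewrite NE.
under eq_bigr => j _ do rewrite -scaler_int.
exact: (sum_frame4 (fun j => (m j)%:~R)).
Qed.

End LatticeFrame.

(** * The group of forms attached to D *)

Theorem mainTheorem1 (R : realType) (L : set 'cV[R[i]]_2) (d : int)
    (D : 'M[R[i]]_2) (hL : is_lattice L) (hd : forall n : int, d != n ^+ 2)
    (hns : ~~ is_scalar_mx D) (hDL : forall x, L x -> L (D *m x))
    (hD : D *m D = (d%:~R)%:M) :
  [/\ iso_Zn 2 (N_D L D),
      (0 < d -> exists2 H, N_D L D H & positive_definite H) &
      (d < 0 -> ~ exists2 H, N_D L D H & positive_definite H)].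
Proof.
have [l1 [l2 [N [Ll1 Ll2 frame N_gt0 N_frame]]]] := lattice_frame hd hD hL hDL.
have d_neq0 : d != 0 by have := hd 0; rewrite expr0n.
split.
- exact: (N_D_iso_Z2 hDL hD hns d_neq0 Ll1 Ll2 frame N_gt0 N_frame).
- exact: (N_D_positive_definite hDL hD hns d_neq0 frame N_gt0 N_frame).
- exact: N_D_not_positive_definite.
Qed.
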